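(* For each integer $t\ge 0$ we have $n_2(4,5+8t,2)=11+15t$, $n_2(4,6+8t,2)=12+15t$, $n_2(4,7+8t,2)=14+15t$, $n_2(4,8+8t,2)=15+15t$, $n_2(4,9+8t,2)=19+15t$, $n_2(4,10+8t,2)=20+15t$, $n_2(4,11+8t,2)=22+15t$, and $n_2(4,12+8t,2)=23+15t$. Moreover, $n_2(4,1,2)=n_2(4,2,2)=6$, $n_2(4,3,2)=8$, and $n_2(4,4,2)=9$.
   Context: An $[n,k,d]_q$-code is a $k$-dimensional subspace of $\mathbb{F}_q^n$ with minimum Hamming distance at least $d$. A linear code $C\subseteq\mathbb{F}_q^n$ has locality $r$ if for every coordinate $i$ there is a set $S_i\subseteq\{1,\dots,n\}\setminus\{i\}$ with $|S_i|\le r$ such that any two codewords agreeing on all coordinates in $S_i$ also agree in coordinate $i$. $n_q(k,d,r)$ denotes the minimum length $n$ of an $[n,k,d]_q$-code with locality $r$. *)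

(* Defs.v *)
From HB Require Import structures.
From mathcomp Require Import all_boot all_order all_algebra.

Set Implicit Arguments.
Unset Strict Implicit.
Unset Printing Implicit Defensive.

Import GRing.Theory.
Local Open Scope ring_scope.

Definition hamming_dist (F : finFieldType) (n : nat) (x y : 'rV[F]_n) : nat :=
  #|[set i : 'I_n | x 0 i != y 0 i]|.

Definition min_dist_ge (F : finFieldType) (n : nat) (C : {vspace 'rV[F]_n})
    (d : nat) : Prop :=
  forall x y : 'rV[F]_n,
    x \in C -> y \in C -> x <> y -> (d <= hamming_dist x y)%N.

Definition is_code (F : finFieldType) (n k d : nat)
    (C : {vspace 'rV[F]_n}) : Prop :=
  \dim C = k /\ min_dist_ge C d.

Definition has_locality (F : finFieldType) (n : nat) (C : {vspace 'rV[F]_n})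
    (r : nat) : Prop :=
  forall i : 'I_n, exists S : {set 'I_n},
    [/\ i \notin S, (#|S| <= r)%N
      & forall x y : 'rV[F]_n, x \in C -> y \in C ->
          (forall j, j \in S -> x 0 j = y 0 j) -> x 0 i = y 0 i].

Definition lrc_exists (F : finFieldType) (n k d r : nat) : Prop :=
  exists C : {vspace 'rV[F]_n}, is_code k d C /\ has_locality C r.

(* "n_q(k,d,r) = n" for F = F_q, as a relation: for some parameters no code
   exists at any length (e.g. k = 1, r = 0), so a total nat-valued function
   would need a junk value. *)
Definition is_min_length (F : finFieldType) (k d r n : nat) : Prop :=
  lrc_exists F n k d r /\ forall m : nat, lrc_exists F m k d r -> (n <= m)%N.

(* Main.v *)
Require Import Defs.
From mathcomp Require Import all_boot all_order all_algebra.
From mathcomp Require Import zify.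

(** Lower bounds: for [d >= 5] they are instances of the Griesmer bound, and for
    [d <= 4] of the Griesmer bound after shortening at a repair group, which
    costs two dimensions but removes three coordinates; moreover locality
    excludes words of weight one, so [d = 1] reduces to [d = 2].

    Upper bounds: a code is given by the multiset of its columns in [F_2^4], and
    it has locality 2 when every column is a sum of two nonzero columns.  Adding
    a copy of the simplex code raises the length by 15, all nonzero weights by 8,
    and preserves this.  The base cases are the simplex code, once or twice, with
    a point, a line or a plane removed, and for [d <= 4] unions of lines on a
    hyperbolic quadric. *)

Set Implicit Arguments.
Unset Strict Implicit.
Unset Printing Implicit Defensive.

Import GRing.Theory.
Local Open Scope ring_scope.

(** * The Griesmer bound *)

(** Iterated upper halves give the usual sum of [ceil(d / 2^i)] over [i < k]. *)
Fixpoint griesmer (k d : nat) : nat :=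
  if k is k'.+1 then (d + griesmer k' (uphalf d))%N else 0%N.

Lemma griesmer_mono (k d e : nat) :
  (d <= e)%N -> (griesmer k d <= griesmer k e)%N.
Proof.
elim: k d e => //= k IH d e le_de.
by apply: leq_add => //; apply: IH; apply: uphalf_leq.
Qed.

(** Counting only on [A] lets residual and shortened codes stay in the original ambient space. *)
Definition weight_on (F : finFieldType) (n : nat) (A : {set 'I_n})
    (x : 'rV[F]_n) : nat :=
  (\sum_(i in A) (x 0%R i != 0%R))%N.

Lemma weight_onE (F : finFieldType) (n : nat) (A : {set 'I_n})
    (x : 'rV[F]_n) :
  weight_on A x = #|[set i in A | x 0 i != 0]|.
Proof. by rewrite /weight_on -big_mkcondr /= sum1dep_card. Qed.

Lemma weight_on_subset (F : finFieldType) (n : nat) (A : {set 'I_n})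
    (x : 'rV[F]_n) :
  (forall i, i \notin A -> x 0 i = 0) -> weight_on A x = hamming_dist x 0.
Proof.
move=> x0; rewrite weight_onE /hamming_dist; apply: eq_card => i.
rewrite !inE mxE; case: (boolP (i \in A)) => //= /x0 ->.
by rewrite eqxx.
Qed.

Lemma F2_cases (x : 'F_2) : x = 0 \/ x = 1.
Proof. by case: x => -[|[|m]] // H; [left | right]; apply/val_inj. Qed.

(** Where [c] is 1, exactly one of [x] and [x + c] is nonzero; where [c] is 0, they agree. *)
Lemma weight_on_residual (n : nat) (A : {set 'I_n}) (c x : 'rV['F_2]_n) :
  (weight_on A x + weight_on A (x + c)
   = weight_on A c + (weight_on (A :\: [set i | c 0%R i != 0%R]) x).*2)%N.
Proof.
have -> : (weight_on (A :\: [set i | c 0%R i != 0%R]) x).*2 =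
    (\sum_(i in A) ((c 0%R i == 0%R) && (x 0%R i != 0%R)).*2)%N.
  rewrite -muln2 big_distrl big_mkcond [in RHS]big_mkcond; apply: eq_bigr => i _.
  rewrite !inE negbK; case: (i \in A); rewrite ?andbF // andbT.
  by case: eqP => //= _; rewrite muln2.
rewrite /weight_on -!big_split; apply: eq_bigr => i _ /=; rewrite mxE.
by case: (F2_cases (c 0 i)) => ->; case: (F2_cases (x 0 i)) => ->.
Qed.

(* The residual code with respect to a word [c] of minimum weight [w] has
   minimum weight at least [w / 2], because [x] and [x + c] both have weight at
   least [w]. *)
Theorem griesmer_bound (n k d : nat) (A : {set 'I_n})
    (U : {vspace 'rV['F_2]_n}) :
  (k <= \dim U)%N ->
  (forall x, x \in U -> x != 0 -> (d <= weight_on A x)%N) ->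
  (griesmer k d <= #|A|)%N.
Proof.
elim: k d A U => // k IH d A U dimU wtU.
pose P := [pred x : 'rV['F_2]_n | (x \in U) && (x != 0)].
have P0 : P (vpick U).
  by rewrite /= memv_pick vpick0 -dimv_eq0 -lt0n (leq_ltn_trans _ dimU).
case: (@arg_minnP _ (vpick U) P (weight_on A) P0) => c /andP[cU c0] cmin.
set w := weight_on A c in cmin.
have le_dw : (d <= w)%N by apply: wtU.
pose A' := A :\: [set i | c 0 i != 0].
have cardA : #|A| = (w + #|A'|)%N.
  rewrite -(cardsID [set i | c 0 i != 0] A) /w weight_onE; congr (_ + _)%N.
  by apply: eq_card => i; rewrite !inE.
have -> : griesmer k.+1 d = (d + griesmer k (uphalf d))%N by [].
rewrite cardA; apply: leq_add => //.
apply: leq_trans (griesmer_mono k (uphalf_leq le_dw)) _.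
(* A complement of the line of [c] loses at most one dimension and contains no nonzero multiple of
   [c], so [x + c] is nonzero below. *)
pose U' := (U :\: <[c]>)%VS.
have U'U : (U' <= U)%VS by apply: diffvSl.
apply: (IH _ _ U') => [|x xU' x0].
  have := dimv_cap_compl U <[c]>.
  have := dimvS (capvSr U <[c]>); rewrite dim_vline c0 -/U' /=.
  by lia.
have xU : x \in U := subvP U'U _ xU'.
have xc0 : x + c != 0.
  apply: contra c0; rewrite addr_eq0 => /eqP xc.
  have : x \in (U' :&: <[c]>)%VS.
    by rewrite memv_cap xU' xc memvN memv_line.
  by rewrite capv_diff memv0 xc oppr_eq0.
have wx : (w <= weight_on A x)%N by apply: cmin; rewrite /= xU x0.
have wxc : (w <= weight_on A (x + c))%N by apply: cmin; rewrite /= memvD.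
have := weight_on_residual A c x; rewrite -/A' -/w.
by rewrite leq_uphalf_double -(leq_add2l w) => <-; apply: leq_add.
Qed.

Lemma min_dist_weight (F : finFieldType) (n d : nat)
    (C : {vspace 'rV[F]_n}) (x : 'rV[F]_n) :
  min_dist_ge C d -> x \in C -> x != 0 -> (d <= hamming_dist x 0)%N.
Proof. by move=> dC xC /eqP x0; apply: dC => //; apply: mem0v. Qed.

Corollary lrc_griesmer (m k d r : nat) :
  lrc_exists 'F_2 m k d r -> (griesmer k d <= m)%N.
Proof.
case=> C [[dimC dC] _].
rewrite -[leqRHS]card_ord -cardsT; apply: (griesmer_bound (U := C)).
  by rewrite dimC.
move=> x xC x0; rewrite weight_on_subset => [|i]; last by rewrite inE.
exact: min_dist_weight dC xC x0.
Qed.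

(** * Shortening and locality *)

Definition shorten (F : finFieldType) (n : nat) (T : {set 'I_n})
    (C : {vspace 'rV[F]_n}) : {vspace 'rV[F]_n} :=
  (C :&: lker (linfun (colsub (@enum_val _ (mem T)) : 'rV_n -> 'rV_#|T|)))%VS.

Lemma mem_shorten (F : finFieldType) (n : nat) (T : {set 'I_n})
    (C : {vspace 'rV[F]_n}) (x : 'rV[F]_n) :
  x \in shorten T C -> x \in C /\ forall i, i \in T -> x 0 i = 0.
Proof.
rewrite memv_cap memv_ker lfunE => /andP[xC /eqP/rowP x0]; split=> // i iT.
by have := x0 (enum_rank_in iT i); rewrite !mxE enum_rankK_in.
Qed.

Lemma dim_shorten (F : finFieldType) (n : nat) (T : {set 'I_n})
    (C : {vspace 'rV[F]_n}) :
  (\dim C <= \dim (shorten T C) + #|T|)%N.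
Proof.
rewrite -(limg_ker_dim (linfun (colsub (@enum_val _ (mem T)) : 'rV_n -> 'rV_#|T|)) C).
rewrite leq_add2l (leq_trans (dimvS (subvf _))) //.
by rewrite dimvf /dim /= mul1n.
Qed.

(** Repair sets may have fewer than [r] elements; padding them makes shortening remove exactly
    [r + 1] coordinates. *)
Lemma extend_set (T : finType) (i : T) (S : {set T}) (r : nat) :
  i \notin S -> (#|S| <= r < #|T|)%N ->
  exists S' : {set T}, [/\ S \subset S', i \notin S' & #|S'| = r].
Proof.
move=> iS /andP[]; elim: r => [|r IH].
  by rewrite leqn0 => /eqP S0 _; exists S.
rewrite leq_eqVlt => /predU1P[Sr _|ltSr ltrT]; first by exists S.
have [//|//|S' [SS' iS' cS']] := IH _ _; first exact: ltnW.
have [j] : exists j, j \in ~: (i |: S').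
  by apply/set0Pn; rewrite -card_gt0 cardsCs setCK cardsU1 iS' cS'; lia.
rewrite !inE negb_or => /andP[ji jS']; exists (j |: S'); split.
- exact: subset_trans SS' (subsetUr _ _).
- by rewrite !inE negb_or eq_sym ji.
- by rewrite cardsU1 jS' cS'.
Qed.

(* Words vanishing on a repair set of [i] also vanish at [i], so shortening at
   [r] coordinates removes [r + 1] of them. *)
Theorem lrc_shortened_griesmer (m k d r : nat) :
  (r < m)%N -> lrc_exists 'F_2 m k d r ->
  (r.+1 + griesmer (k - r) d <= m)%N.
Proof.
move=> lt_rm [C [[dimC dC] locC]].
have [S [iS cS repS]] := locC (Ordinal (leq_ltn_trans (leq0n r) lt_rm)).
set i := Ordinal _ in iS repS.
have [|T [ST iT cT]] := @extend_set _ i S r iS; first by rewrite cS card_ord.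
have cA : (r.+1 + #|~: (i |: T)|)%N = m.
  by rewrite -[RHS]card_ord -(cardsC (i |: T)) cardsU1 iT cT.
rewrite -[leqRHS]cA leq_add2l; apply: (griesmer_bound (U := shorten T C)).
  by rewrite leq_subLR -dimC -cT addnC dim_shorten.
move=> x /mem_shorten[xC xT] x0.
rewrite weight_on_subset => [|j]; first exact: min_dist_weight dC xC x0.
rewrite in_setC negbK => /setU1P[->|/xT //].
rewrite (repS x 0) ?mem0v ?mxE // => j' j'S.
by rewrite xT ?mxE // (subsetP ST).
Qed.

(** Codewords that differ at [i] also differ somewhere on its repair set, which omits [i]. *)
Lemma locality_min_dist2 (F : finFieldType) (n r : nat)
    (C : {vspace 'rV[F]_n}) :
  has_locality C r -> min_dist_ge C 2.
Proof.
move=> locC x y xC yC /eqP; apply: contraR; rewrite -ltnNge ltnS => lexy.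
apply/eqP/rowP => i; have [S [iS _ repS]] := locC i.
case: (x 0 i =P y 0 i) => // /eqP ne_i; apply: repS => // j jS.
apply/eqP; apply: contraTT lexy => ne_j; rewrite -ltnNge.
apply: (@leq_trans #|[set i; j]|).
  by rewrite cards2; case: eqP iS => // ->; rewrite jS.
apply: subset_leq_card; apply/subsetP => l.
by rewrite !inE => /orP[] /eqP ->.
Qed.

Lemma lrc_dist1 (F : finFieldType) (n k r : nat) :
  lrc_exists F n k 1 r <-> lrc_exists F n k 2 r.
Proof.
split=> -[C [[dimC dC] locC]]; exists C; split=> //; split=> //.
  exact: locality_min_dist2 locC.
by move=> x y xC yC xy; apply: leq_trans (dC x y xC yC xy).
Qed.

(** * Codes given by their columns *)

Definition dotr (F : finFieldType) (k : nat) (u v : 'rV[F]_k) : F :=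
  \sum_j u 0 j * v 0 j.

Definition column_code (F : finFieldType) (k : nat) (s : seq 'rV[F]_k) :
    {vspace 'rV[F]_(size s)} :=
  limg (linfun (mulmxr (\matrix_(j < k, i < size s) nth 0 s i 0 j) :
                  'rV[F]_k -> 'rV[F]_(size s))).

Section ColumnCode.

Variables (F : finFieldType) (k : nat) (s : seq 'rV[F]_k).

Lemma column_codeP (x : 'rV[F]_(size s)) :
  reflect (exists u, x = \row_i dotr u (nth 0 s i)) (x \in column_code s).
Proof.
apply: (iffP memv_imgP) => [[u _ ->]|[u ->]]; exists u; rewrite ?memvf //;
  by rewrite lfunE /=; apply/rowP => i; rewrite !mxE; apply: eq_bigr => j _;
     rewrite mxE.
Qed.

Lemma dotrDr (u v w : 'rV[F]_k) : dotr u (v + w) = dotr u v + dotr u w.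
Proof. by rewrite /dotr -big_split; apply: eq_bigr => j _; rewrite mxE mulrDr. Qed.

Lemma dotrBl (u v w : 'rV[F]_k) : dotr (u - v) w = dotr u w - dotr v w.
Proof. by rewrite /dotr -sumrB; apply: eq_bigr => j _; rewrite !mxE mulrBl. Qed.

Lemma hamming_dist_column_code (u v : 'rV[F]_k) :
  hamming_dist (\row_(i < size s) dotr u (nth 0 s i)) (\row_i dotr v (nth 0 s i))
  = count (fun w => dotr (u - v) w != 0) s.
Proof.
rewrite /hamming_dist -sum1_count (big_nth 0) big_mkord sum1dep_card.
by apply: eq_card => i; rewrite !inE !mxE dotrBl subr_eq0.
Qed.

(** A nonzero [u] encoded as the zero word would have weight [0 < d], so encoding is injective and
    the dimension is [k]. *)
Lemma column_code_is_code (d : nat) :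
  (0 < d)%N ->
  (forall u, u != 0 -> (d <= count (fun w => dotr u w != 0%R) s)%N) ->
  is_code k d (column_code s).
Proof.
move=> d0 wt; split; last first.
  move=> _ _ /column_codeP[u ->] /column_codeP[v ->] uv.
  rewrite hamming_dist_column_code wt // subr_eq0.
  by apply: contra_notN uv => /eqP ->.
rewrite /column_code limg_dim_eq ?dimvf ?/dim /= ?mul1n //.
apply/eqP; rewrite capfv -subv0; apply/subvP => u.
rewrite memv_ker lfunE memv0 => /eqP/rowP u0.
apply/negPn/negP => /wt; apply/negP; rewrite -ltnNge.
suff -> : count (fun w => dotr u w != 0) s = 0%N by [].
rewrite -[u]subr0 -hamming_dist_column_code; apply: eq_card0 => i.
rewrite !inE !mxE; apply/negbF; have := u0 i; rewrite !mxE => dot0.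
rewrite [X in X == _](_ : _ = 0) ?[X in _ == X](_ : _ = 0) //.
  by rewrite /dotr big1 // => j _; rewrite mxE mul0r.
by rewrite -[RHS]dot0; apply: eq_bigr => j _; rewrite mxE.
Qed.

(** The entry at [a + b] is the sum of those at [a] and [b]; as both are nonzero, neither equals the
    column being repaired. *)
Lemma column_code_locality :
  (forall v, v \in s -> exists a b,
     [/\ a \in s, b \in s, a != 0, b != 0 & v = a + b]) ->
  has_locality (column_code s) 2.
Proof.
move=> repair i; have [|a [b [sa sb a0 b0 ab]]] := repair (nth 0 s i).
  exact: mem_nth.
have ia : (index a s < size s)%N by rewrite index_mem.
have ib : (index b s < size s)%N by rewrite index_mem.
exists [set Ordinal ia; Ordinal ib]; split.
- rewrite !inE negb_or; apply/andP; split; apply/eqP => Ei.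
    move/eqP: ab; rewrite Ei /= nth_index // -subr_eq0 opprD addrA subrr sub0r.
    by rewrite oppr_eq0 (negPf b0).
  move/eqP: ab; rewrite Ei /= nth_index // -subr_eq0 addrC opprD addrNK.
  by rewrite oppr_eq0 (negPf a0).
- by rewrite cards2; case: (_ != _).
- move=> _ _ /column_codeP[u ->] /column_codeP[v ->] agree.
  have := agree (Ordinal ia); have := agree (Ordinal ib).
  by rewrite !inE !eqxx orbT !mxE /= !nth_index // ab !dotrDr => -> // ->.
Qed.

End ColumnCode.

(** * Deciding weights and repair over [F_2^4] by computation *)

Definition bit (m i : nat) : bool := odd (m %/ 2 ^ i).

(* The number [m < 16] stands for the point of [F_2^4] with the binary digits
   of [m] as coordinates, so [iota 1 15] lists the columns of the simplex
   code. *)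
Definition point (m : nat) : 'rV['F_2]_4 := \row_i (bit m i)%:R.

Definition dot_bits (a m : nat) : bool :=
  (bit a 0 && bit m 0) (+) (bit a 1 && bit m 1)
  (+) (bit a 2 && bit m 2) (+) (bit a 3 && bit m 3).

Definition weights_ge (d : nat) (s : seq nat) : bool :=
  all (fun a => d <= count (dot_bits a) s)%N (iota 1 15).

Definition repairable (s : seq nat) : bool :=
  all (fun m => has (fun a => has (fun b =>
    [&& has (bit a) (iota 0 4), has (bit b) (iota 0 4) &
        all (fun i => bit m i == bit a i (+) bit b i) (iota 0 4)]) s) s) s.

Lemma F2_bit (b : bool) : (b%:R != 0 :> 'F_2) = b.
Proof. by case: b. Qed.

Lemma F2_addb (a b : bool) : (a (+) b)%:R = a%:R + b%:R :> 'F_2.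
Proof. by case: a; case: b; apply/val_inj. Qed.

Lemma F2_andb (a b : bool) : (a && b)%:R = a%:R * b%:R :> 'F_2.
Proof. by case: a; case: b; apply/val_inj. Qed.

Lemma dotr_point (a m : nat) : dotr (point a) (point m) = (dot_bits a m)%:R.
Proof.
rewrite /dotr /dot_bits !F2_addb !F2_andb !big_ord_recl big_ord0 !mxE addr0.
by rewrite !addrA.
Qed.

Lemma point_neq0 (m : nat) : (point m != 0) = has (bit m) (iota 0 4).
Proof.
apply/idP/hasP => [|[i]].
  rewrite -[point m != 0]negbK => /negP nz; apply/hasP/negPn/negP => /hasPn m0.
  apply: nz; rewrite negbK; apply/eqP/rowP => i; rewrite !mxE.
  by rewrite (negPf (m0 i _)) // mem_iota ltn_ord.
rewrite mem_iota => /= lti mi; apply/eqP => /rowP/(_ (Ordinal lti)).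
by rewrite !mxE /= mi => /eqP; rewrite oner_eq0.
Qed.

Lemma pointP (u : 'rV['F_2]_4) : u != 0 -> exists2 a, a \in iota 1 15 & u = point a.
Proof.
move=> u0; pose c i := u 0 (inord i) != 0.
pose a := (c 0 + 2 * c 1 + 4 * c 2 + 8 * c 3)%N.
have ua : u = point a.
  apply/rowP => i; rewrite mxE.
  have -> : bit a i = (u 0 i != 0).
    rewrite -[i in RHS]inord_val -/(c i) /a.
    case: i => -[|[|[|[|//]]]] _ /=;
    by case: (c 0); case: (c 1); case: (c 2); case: (c 3).
  by case: (F2_cases (u 0 i)) => ->.
exists a => //; rewrite mem_iota; have : a != 0%N.
  by apply: contraNneq u0 => a0; rewrite ua a0; apply/eqP/rowP => i; rewrite !mxE /bit div0n.
by rewrite /a; case: (c 0); case: (c 1); case: (c 2); case: (c 3).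
Qed.

Lemma lrc_of_points (d : nat) (s : seq nat) :
  (0 < d)%N -> weights_ge d s -> repairable s ->
  lrc_exists 'F_2 (size s) 4 d 2.
Proof.
move=> d0 /allP wt /allP rep; rewrite -(size_map point s).
exists (column_code (map point s)); split.
  apply: column_code_is_code => // u /pointP[a /wt wa ->].
  rewrite count_map (leq_trans wa) // -(eq_count (a1 := dot_bits a)) // => m /=.
  by rewrite dotr_point F2_bit.
apply: column_code_locality => _ /mapP[m /rep/hasP[a sa /hasP[b sb ab]] ->].
case/and3P: ab; rewrite -!point_neq0 => a0 b0 /allP mab.
exists (point a), (point b); split=> //; try exact: map_f.
apply/rowP => i; rewrite !mxE -F2_addb; congr (nat_of_bool _)%:R.
by apply/eqP/mab; rewrite mem_iota ltn_ord.
Qed.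

Lemma repairable_cat (s1 s2 : seq nat) :
  repairable s1 -> repairable s2 -> repairable (s1 ++ s2).
Proof.
rewrite /repairable all_cat => /allP r1 /allP r2.
apply/andP; split; apply/allP => m.
  move=> /r1/hasP[a sa /hasP[b sb ab]].
  by apply/hasP; exists a; rewrite ?mem_cat ?sa //; apply/hasP; exists b; rewrite ?mem_cat ?sb.
move=> /r2/hasP[a sa /hasP[b sb ab]].
by apply/hasP; exists a; rewrite ?mem_cat ?sa ?orbT //; apply/hasP; exists b; rewrite ?mem_cat ?sb ?orbT.
Qed.

Lemma lrc_add_simplex (d : nat) (s : seq nat) (t : nat) :
  (0 < d)%N -> weights_ge d s -> repairable s ->
  lrc_exists 'F_2 (size s + 15 * t) 4 (d + 8 * t) 2.
Proof.
move=> d0 wt rep; pose s' t := iter t (cat (iota 1 15)) s.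
have s'S u : s' u.+1 = iota 1 15 ++ s' u by [].
have <- : size (s' t) = (size s + 15 * t)%N.
  elim: t => [|t IH]; first by rewrite muln0 addn0.
  by rewrite s'S size_cat IH size_iota; lia.
apply: lrc_of_points; first by rewrite addn_gt0 d0.
  elim: t => [|t /allP IH]; first by rewrite muln0 addn0.
  apply/allP => a ia; rewrite s'S count_cat mulnSr addnA addnC leq_add //.
    (* Every nonzero word of the simplex code has weight 8. *)
    by move: a ia {IH}; apply/allP; vm_compute.
  exact: IH.
by elim: t => // t IH; rewrite s'S; apply: repairable_cat => //.
Qed.

Theorem theorem27 :
  (forall t : nat,
     is_min_length 'F_2 4 (5 + 8 * t) 2 (11 + 15 * t) /\
     is_min_length 'F_2 4 (6 + 8 * t) 2 (12 + 15 * t) /\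
     is_min_length 'F_2 4 (7 + 8 * t) 2 (14 + 15 * t) /\
     is_min_length 'F_2 4 (8 + 8 * t) 2 (15 + 15 * t) /\
     is_min_length 'F_2 4 (9 + 8 * t) 2 (19 + 15 * t) /\
     is_min_length 'F_2 4 (10 + 8 * t) 2 (20 + 15 * t) /\
     is_min_length 'F_2 4 (11 + 8 * t) 2 (22 + 15 * t) /\
     is_min_length 'F_2 4 (12 + 8 * t) 2 (23 + 15 * t)) /\
  is_min_length 'F_2 4 1 2 6 /\
  is_min_length 'F_2 4 2 2 6 /\
  is_min_length 'F_2 4 3 2 8 /\
  is_min_length 'F_2 4 4 2 9.
Proof.
have short_bound d m : (0 < d)%N ->
    lrc_exists 'F_2 m 4 d 2 -> (3 + griesmer 2 d <= m)%N.
  move=> d0 lrc; have m4 := lrc_griesmer lrc.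
  by apply: lrc_shortened_griesmer lrc; move: m4 d0 => /=; lia.
split=> [t|].
  (* The bound grows by [8t + 4t + 2t + t = 15t], the length of [t] simplex codes. *)
  have optimal s d : (0 < d)%N -> weights_ge d s -> repairable s ->
      (size s + 15 * t <= griesmer 4 (d + 8 * t))%N ->
      is_min_length 'F_2 4 (d + 8 * t) 2 (size s + 15 * t).
    move=> d0 wt rep le_s; split; first exact: lrc_add_simplex.
    by move=> m /lrc_griesmer; apply: leq_trans.
  (* [1, 2, 3] is a line, [1 .. 7] a plane and [1, 8, 9] a line meeting it in a
     point. *)
  split; first by apply: (optimal (iota 5 11)) => //; rewrite /=; lia.
  split; first by apply: (optimal (iota 4 12)) => //; rewrite /=; lia.
  split; first by apply: (optimal (iota 2 14)) => //; rewrite /=; lia.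
  split; first by apply: (optimal (iota 1 15)) => //; rewrite /=; lia.
  split.
    (* The plane and the line share the point 1, so both copies lose it; the point 10 goes too,
       leaving weight at least [16 - 4 - 2 - 1]. *)
    by apply: (optimal (iota 2 14 ++ iota 11 5)) => //; rewrite /=; lia.
  split.
    by apply: (optimal (iota 2 14 ++ iota 10 6)) => //; rewrite /=; lia.
  split.
    by apply: (optimal (iota 1 15 ++ iota 9 7)) => //; rewrite /=; lia.
  by apply: (optimal (iota 1 15 ++ iota 8 8)) => //; rewrite /=; lia.
have optimal s d : (0 < d)%N -> weights_ge d s -> repairable s ->
    (size s <= 3 + griesmer 2 d)%N -> is_min_length 'F_2 4 d 2 (size s).
  move=> d0 wt rep le_s; split; first exact: lrc_of_points.
  by move=> m /(short_bound _ _ d0); apply: leq_trans.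
(* The points [a (x) b] of the quadric form a 3 x 3 grid with rows [1, 2, 3],
   [4, 8, 12], [5, 10, 15] and columns [1, 4, 5], [2, 8, 10], [3, 12, 15]. *)
have optimal2 := optimal [:: 1; 2; 3; 4; 8; 12]%N 2 isT isT isT isT.
split.
  case: optimal2 => ex min2; split; first exact/lrc_dist1.
  by move=> m /lrc_dist1/min2.
split; first exact: optimal2.
(* The grid without 15: the points 5 and 10 are repaired along their columns. *)
split; first exact: (optimal [:: 1; 2; 3; 4; 8; 12; 5; 10]%N).
exact: (optimal [:: 1; 2; 3; 4; 8; 12; 5; 10; 15]%N).
Qed.
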